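(* For each $n\ge 2$ let $\mathcal{A}$ be an allocation algorithm on $2n$ subjects that begins by choosing uniformly at random $n$ of the $2n$ subjects for assignment to treatment (the others being assigned to control), and suppose there is a fixed set of indices $A=A_n\subseteq\{1,\dots,2n\}$, not depending on the randomization, such that all subjects indexed by $A$ retain in the final allocation the assignment given by the initial randomization. If $$\lim_{n\to\infty}\frac{|A|}{2n}=1,$$ then $$\lim_{n\to\infty}E_n=1\qquad\text{and}\qquad \lim_{n\to\infty}D_n=0 .$$
   Context: An allocation divides $2n$ subjects into a treatment group of size $n$ and a control group of size $n$. Let $S=\{(i,j): 1\le i<j\le 2n\}$, so $|S|=\binom{2n}{2}$. For an allocation algorithm and $s=(i,j)\in S$, let $p_s$ be the probability that subjects $i$ and $j$ are in the same group in the final allocation. Let $s_n=\frac{n-1}{2n-1}$, which is the value of $p_s$ when all $\binom{2n}{n}$ allocations are equally likely. The pairwise entropy metric is $$E_n=\frac{1}{|S|}\,\frac{\sum_{s\in S}\left[p_s\ln(p_s)+(1-p_s)\ln(1-p_s)\right]}{s_n\ln(s_n)+(1-s_n)\ln(1-s_n)},$$ with the convention $0\cdot\ln(0)=0$, and the standard error metric is $$D_n=\frac1n\sqrt{\frac{2n-1}{n-1}\sum_{s\in S}\left(p_s-\frac{n-1}{2n-1}\right)^2}.$$ *)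

(* Defs.v *)
From HB Require Import structures.
From mathcomp Require Import all_boot all_order all_algebra.
From mathcomp Require Import all_classical all_reals all_analysis.

Set Implicit Arguments.
Unset Strict Implicit.
Unset Printing Implicit Defensive.

Import Order.TTheory GRing.Theory Num.Theory.

Local Open Scope classical_set_scope.
Local Open Scope ring_scope.

(* An allocation of the subjects 0, ..., 2n-1 is given by its treatment group;
   the control group is the complement. *)
Definition allocation (n : nat) : Type := {B : {set 'I_(2 * n)} | #|B| == n}.

Definition treated (n : nat) (B : allocation n) (i : 'I_(2 * n)) : bool :=
  i \in sval B.

Definition pairs (n : nat) : {set 'I_(2 * n) * 'I_(2 * n)} :=
  [set s : 'I_(2 * n) * 'I_(2 * n) | (s.1 < s.2)%N].

(* Measurability for the discrete sigma-algebra on the finite set of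
   allocations. *)
Definition random_allocation (d : measure_display) (T : measurableType d)
    (n : nat) (F : T -> allocation n) : Prop :=
  forall B : allocation n, measurable (F @^-1` [set B]).

Definition uniform_allocation (R : realType) (d : measure_display)
    (T : measurableType d) (P : probability T R) (n : nat)
    (F : T -> allocation n) : Prop :=
  random_allocation F /\
  forall B : allocation n, P (F @^-1` [set B]) = ('C(2 * n, n)%:R^-1)%:E.

Definition same_group_prob (R : realType) (d : measure_display)
    (T : measurableType d) (P : probability T R) (n : nat)
    (F : T -> allocation n) (s : 'I_(2 * n) * 'I_(2 * n)) : R :=
  fine (P [set w | treated (F w) s.1 = treated (F w) s.2]).

Definition s_ (R : realType) (n : nat) : R := (n%:R - 1) / (2 * n%:R - 1).

(* The convention 0 * ln 0 = 0 holds automatically, ln being total. *)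
Definition plnp (R : realType) (p : R) : R := p * ln p + (1 - p) * ln (1 - p).

Definition pairwise_entropy (R : realType) (d : measure_display)
    (T : measurableType d) (P : probability T R) (n : nat)
    (F : T -> allocation n) : R :=
  (#|pairs n|%:R)^-1 *
  ((\sum_(s in pairs n) plnp (same_group_prob P F s)) / plnp (s_ R n)).

Definition standard_error (R : realType) (d : measure_display)
    (T : measurableType d) (P : probability T R) (n : nat)
    (F : T -> allocation n) : R :=
  n%:R^-1 *
  Num.sqrt ((2 * n%:R - 1) / (n%:R - 1) *
            \sum_(s in pairs n)
              (same_group_prob P F s - (n%:R - 1) / (2 * n%:R - 1)) ^+ 2).

(* Main.v *)
(** A pair of subjects in [A] is in the same final group exactly when it was in
    the same initial group, so its [p_s] equals [s_n], the uniform value. With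
    [e = 1 - |A|/2n], at most [8 n^2 e] pairs are not contained in [A], out of
    at least [n^2]. Writing [h = plnp], for every [p] in [0, 1]
      [- 1 <= h p <= - 2 p (1 - p)],
    which follows from [ln x <= x - 1] at [p] and [1/p]; moreover
    [h s_n <= - 1/3]. Hence each exceptional pair contributes at most
    [3 / |S|] to [1 - E_n], so that [|1 - E_n| <= 24 e]; it contributes at
    most 1 to the sum in [D_n], so that [D_n <= sqrt (24 e)]. *)

Require Import Defs.
From HB Require Import structures.
From mathcomp Require Import all_boot all_order all_algebra.
From mathcomp Require Import all_classical all_reals all_analysis.
From mathcomp Require Import ring lra zify.
Import Order.TTheory GRing.Theory Num.Theory.
Import numFieldNormedType.Exports.
Local Open Scope classical_set_scope.
Local Open Scope ring_scope.

(** * Counting allocations that separate a given pair *)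

(** Adjoining [i] is a bijection from the [k]-subsets of the complement of [{i, j}] onto these sets;
    its inverse removes [i]. *)
Lemma card_draws_separating (T : finType) (k : nat) (i j : T) : i != j ->
  #|[set B : {set T} | [&& #|B| == k.+1, i \in B & j \notin B]]%SET|
  = 'C(#|T|.-2, k).
Proof.
move=> ij; have c2 : #|~: [set i; j]%SET| = #|T|.-2.
  by rewrite cardsCs finset.setCK cards2 ij subn2.
rewrite -c2 -cards_draws -[RHS](card_in_imset (f := fun B => i |: B)%SET);
  last first.
  move=> B C; rewrite !inE => /andP[/fintype.subsetP BS _].
  move=> /andP[/fintype.subsetP CS _] BC.
  have iB : i \notin B by apply/negP => /BS; rewrite !inE eqxx.
  have iC : i \notin C by apply/negP => /CS; rewrite !inE eqxx.
  by rewrite -(setU1K iB) BC setU1K.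
apply: eq_card => B; apply/idP/imsetP; rewrite inE.
  move=> /and3P[/eqP cB iB jB]; exists (B :\ i)%SET;
    last by rewrite finset.setD1K.
  rewrite inE; apply/andP; split; last by rewrite -eqSS -cB (cardsD1 i B) iB.
  apply/fintype.subsetP => x; rewrite !inE negb_or => /andP[-> xB] /=.
  by apply: contraNneq jB => <-.
move=> [C]; rewrite inE => /andP[/fintype.subsetP CS /eqP cC ->].
have iC : i \notin C by apply/negP => /CS; rewrite !inE eqxx.
have jC : j \notin C by apply/negP => /CS; rewrite !inE eqxx orbT.
by rewrite /= cardsU1 iC cC !inE !eqxx /= eq_sym (negbTE ij).
Qed.

Lemma card_allocation (n : nat) : #|{: allocation n}| = 'C(2 * n, n).
Proof.
rewrite card_sig; have := card_draws 'I_(2 * n) n; rewrite card_ord => <-.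
by apply: eq_card => B; rewrite !inE.
Qed.

(** A pair is separated in two exclusive ways, according to which of the two subjects is treated,
    and each way is a case of [card_draws_separating]. The additive form avoids truncated
    subtraction. *)
Lemma card_same_group (n : nat) (i j : 'I_(2 * n)) : i != j ->
  (#|[pred B : allocation n | treated B i == treated B j]|
    + 2 * 'C((2 * n).-2, n.-1))%N = 'C(2 * n, n).
Proof.
move=> ij; have n0 : (0 < n)%N by have := ltn_ord i; lia.
have cD (u v : 'I_(2 * n)) : u != v ->
    #|[pred B : allocation n | treated B u && ~~ treated B v]|
    = 'C((2 * n).-2, n.-1).
  move=> uv; have := card_draws_separating _ n.-1 _ _ uv.
  rewrite card_ord prednK // => <-.
  rewrite -(card_imset _ val_inj); apply: eq_card => B.
  rewrite [RHS]inE; apply/imsetP/idP.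
    by move=> [C]; rewrite inE => /andP[uC vC] ->;
      apply/and3P; split=> //; exact: (valP C).
  move=> /and3P[cB uB vB]; exists (Sub B cB : allocation n);
    by rewrite // inE /treated /= uB.
rewrite -card_allocation -[RHS](cardID
  [pred B : allocation n | treated B i == treated B j]).
congr (_ + _)%N.
rewrite mul2n -addnn -{1}(cD i j) // -(cD j i); last by rewrite eq_sym.
rewrite -cardUI [X in (_ + X)%N]eq_card0 ?addn0; last first.
  by move=> B; rewrite !inE; case: (treated B i); case: (treated B j).
by apply: eq_card => B; rewrite !inE; case: (treated B i); case: (treated B j).
Qed.

(** In probabilities: a uniform allocation separates a pair with probability [n / (2n - 1)], that
    is, [1 - s_n]. *)
Lemma mul_bin_central (n : nat) : (1 <= n)%N ->
  ((2 * n).-1 * 'C((2 * n).-2, n.-1) * 2 = n * 'C(2 * n, n))%N.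
Proof.
case: n => // m _; have -> : (2 * m.+1 = (m + m).+2)%N by lia.
have /= diag := mul_bin_diag (m + m).+2 m.
have /= := mul_bin_down (m + m).+1 m.
have -> : ((m + m).+1 - m = m.+1)%N by lia.
move=> -> /=; rewrite -diag; nia.
Qed.

(** * Probabilities of events determined by an allocation *)

Lemma measurable_random_allocation (d : measure_display) (T : measurableType d)
    (n : nat) (F : T -> allocation n) (Q : pred (allocation n)) :
  random_allocation F -> measurable (F @^-1` [set` Q]).
Proof.
move=> mF; have -> : F @^-1` [set` Q] = \bigcup_(B in [set` Q]) F @^-1` [set B].
  by apply/seteqP; split=> w /=; [exists (F w)|move=> [B QB ->]].
by apply: fin_bigcup_measurable => // B _; exact: mF.
Qed.

(** The event is a finite disjoint union of fibres of [F], all of the same probability. *)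
Lemma probability_uniform_allocation (R : realType) (d : measure_display)
    (T : measurableType d) (P : probability T R) (n : nat)
    (F : T -> allocation n) (Q : pred (allocation n)) :
  uniform_allocation P F ->
  P (F @^-1` [set` Q]) = (#|Q|%:R / 'C(2 * n, n)%:R)%:E.
Proof.
move=> [mF uF].
have -> : F @^-1` [set` Q] = \bigcup_(B in [set` enum Q]) F @^-1` [set B].
  apply/seteqP; split=> w /=.
    by move=> Qw; exists (F w) => //=; rewrite mem_enum.
  by move=> [B /=]; rewrite mem_enum => QB ->.
rewrite measure_fin_bigcup //; last by move=> B C _ _ [w [/= -> ->]].
rewrite -fsbig_seq ?enum_uniq // big_enum /=.
under eq_bigr do rewrite uF.
by rewrite sumEFin sumr_const mulr_natl.
Qed.

Section same_group.
Context (R : realType) (d : measure_display) (T : measurableType d).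
Context (P : probability T R) (n : nat) (F : T -> allocation n).

Lemma same_group_event (s : 'I_(2 * n) * 'I_(2 * n)) :
  [set w | treated (F w) s.1 = treated (F w) s.2] =
  F @^-1` [set` [pred B : allocation n | treated B s.1 == treated B s.2]].
Proof. by apply/seteqP; split=> w /=; rewrite inE => /eqP. Qed.

Lemma same_group_prob_itv (s : 'I_(2 * n) * 'I_(2 * n)) :
  random_allocation F -> 0 <= same_group_prob P F s <= 1.
Proof.
move=> mF; rewrite /same_group_prob same_group_event.
have mE := measurable_random_allocation _ _ _ _
  [pred B : allocation n | treated B s.1 == treated B s.2] mF.
rewrite fine_ge0 //= -lee_fin fineK ?probability_le1 //.
exact: fin_num_measure.
Qed.

Lemma same_group_prob_uniform (s : 'I_(2 * n) * 'I_(2 * n)) :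
  uniform_allocation P F -> s.1 != s.2 -> same_group_prob P F s = s_ R n.
Proof.
move=> uF s12; rewrite /same_group_prob same_group_event.
rewrite probability_uniform_allocation //=.
have n0 : (0 < n)%N by have := ltn_ord s.1; lia.
have /(congr1 (GRing.natmul (1 : R))) := card_same_group _ _ _ s12.
have /(congr1 (GRing.natmul (1 : R))) := mul_bin_central _ n0.
have C0 : ('C(2 * n, n)%:R : R) != 0 by rewrite pnatr_eq0 -lt0n bin_gt0; lia.
have n1 : (1 : R) <= n%:R by rewrite ler1n.
have e : ((2 * n).-1%:R : R) = 2 * n%:R - 1.
  by rewrite -subn1 natrB ?natrM //; lia.
rewrite natrD !natrM e /s_ => h1 h2.
have N0 : 2 * n%:R - 1 != 0 :> R by apply: lt0r_neq0; lra.
apply/eqP; rewrite eqr_div //; apply/eqP.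
(* By [h2] the favourable count is the total [C] minus the separating count, and by [h1] the latter
   times [2n - 1] is [n C]; so [2n - 1] times the favourable count is [(n - 1) C]. *)
rewrite -h2; nra.
Qed.

End same_group.

(** * Bounds on the entropy function *)

Lemma xlnx_bounds (R : realType) (p : R) : 0 <= p <= 1 ->
  p - 1 <= p * ln p <= - (p * (1 - p)).
Proof.
(* The case [p = 0] is separate because the lower bound goes through [p^-1]. *)
move=> /andP[p0 p1]; have [->|pN0] := eqVneq p 0; first by rewrite !mul0r; lra.
have p_gt0 : 0 < p by rewrite lt0r pN0.
have upper : ln p <= p - 1.
  by rewrite -[X in ln X](subrKC 1); apply: le_ln1Dx; lra.
have lower : - ln p <= p^-1 - 1.
  have pV_gt0 : 0 < p^-1 by rewrite invr_gt0.
  by rewrite -lnV ?posrE // -[X in ln X](subrKC 1); apply: le_ln1Dx; lra.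
have := ler_wpM2l p0 upper; have := ler_wpM2l p0 lower.
by rewrite !mulrBr mulfV // => ? ?; apply/andP; split; lra.
Qed.

(** Add the bounds of [xlnx_bounds] at [p] and at [1 - p]: the lower ones, [p - 1] and [- p], sum to
    [-1]. *)
Lemma plnp_bounds (R : realType) (p : R) : 0 <= p <= 1 ->
  -1 <= plnp p <= - (2 * (p * (1 - p))).
Proof.
move=> p01; have /xlnx_bounds : 0 <= 1 - p <= 1 by lra.
by have := xlnx_bounds _ _ p01; rewrite /plnp; lra.
Qed.

Lemma s_itv (R : realType) (n : nat) : (2 <= n)%N -> 0 <= s_ R n <= 1.
Proof.
move=> n2; have n2R : (2 : R) <= n%:R by rewrite ler_nat.
by rewrite /s_ divr_ge0 ?ler_pdivrMr ?mul1r; lra.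
Qed.

(** Keeps the denominator of [E_n] away from 0. The upper bound of [plnp_bounds] is
    [- 2n(n - 1) / (2n - 1)^2] here, and the claim reduces to [2n(n - 1) >= 1]. *)
Lemma plnp_s_le (R : realType) (n : nat) : (2 <= n)%N ->
  plnp (s_ R n) <= - 3^-1.
Proof.
move=> n2; have n2R : (2 : R) <= n%:R by rewrite ler_nat.
have /andP[_ h] := plnp_bounds _ _ (s_itv R n n2); apply: le_trans h _.
have N0 : 0 < 2 * n%:R - 1 :> R by lra.
have -> : s_ R n * (1 - s_ R n) = n%:R * (n%:R - 1) / (2 * n%:R - 1) ^+ 2.
  by rewrite /s_; field; rewrite gt_eqF.
rewrite lerN2 mulrA ler_pdivlMr ?exprn_gt0 //; nra.
Qed.

(** * Counting pairs, and sums supported on the exceptional ones *)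

(** The pairs, their swaps and the diagonal cover the whole square, so [4n^2 <= 2|S| + 2n]; then
    [n <= n^2] finishes. *)
Lemma card_pairs_ge (n : nat) : (n ^ 2 <= #|pairs n|)%N.
Proof.
pose swap (s : 'I_(2 * n) * 'I_(2 * n)) := (s.2, s.1).
pose diag (i : 'I_(2 * n)) := (i, i).
have cov : [set: 'I_(2 * n) * 'I_(2 * n)]%SET \subset
    pairs n :|: swap @: pairs n :|: diag @: [set: 'I_(2 * n)]%SET.
  apply/fintype.subsetP => -[i j] _; rewrite !finset.in_setU.
  have [ij|ji|/val_inj ->] := ltngtP i j.
  - by rewrite inE /= ij.
  - apply/orP; left; apply/orP; right; apply/imsetP.
    by exists (j, i); rewrite // inE.
  - by apply/orP; right; apply/imsetP; exists j.
have := subset_leq_card cov; rewrite cardsT card_prod card_ord.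
have := leq_card_setU (pairs n :|: swap @: pairs n)
  (diag @: [set: 'I_(2 * n)]%SET).
have := leq_card_setU (pairs n) (swap @: pairs n).
have := leq_imset_card swap (pairs n).
have := leq_imset_card diag [set: 'I_(2 * n)]%SET.
rewrite cardsT card_ord.
move=> d_le s_le U_le V_le T_le; rewrite -mulnn.
have := leq_trans T_le (leq_trans V_le
  (leq_add (leq_trans U_le (leq_add (leqnn _) s_le)) d_le)).
have : (n <= n * n)%N by case: (n) => // m; rewrite leq_pmulr.
by clear; move: #|_| => N; lia.
Qed.

(** An exceptional pair lies in one of two strips, having its first or its second coordinate outside
    [A]. *)
Lemma card_pairs_notin (n : nat) (A : {set 'I_(2 * n)}) :
  (#|[set s in pairs n | ~~ ((s.1 \in A) && (s.2 \in A))]%SET|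
    <= 2 * ((2 * n - #|A|) * (2 * n)))%N.
Proof.
have cov : [set s in pairs n | ~~ ((s.1 \in A) && (s.2 \in A))]%SET \subset
    finset.setX (~: A) [set: 'I_(2 * n)]%SET
    :|: finset.setX [set: 'I_(2 * n)]%SET (~: A).
  by apply/fintype.subsetP => -[i j]; rewrite !inE /= negb_and andbT => /andP[].
apply: leq_trans (subset_leq_card cov) _.
apply: leq_trans (leq_card_setU _ _) _.
have cC : #|~: A| = (2 * n - #|A|)%N by rewrite cardsCs finset.setCK card_ord.
by rewrite !cardsX cC cardsT card_ord; move: #|_| => a; lia.
Qed.

(** The estimate shared by both metrics, applied with [c = 3] for [E_n] and [c = 1] for [D_n]. The
    factor 8 comes from [2 (2n - |A|) (2n) = 8 n^2 (1 - |A|/2n)]. *)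
Lemma sum_pairs_le (R : realType) (n : nat) (A : {set 'I_(2 * n)})
    (f : 'I_(2 * n) * 'I_(2 * n) -> R) (c : R) :
  (0 < n)%N ->
  (forall s, s \in pairs n -> s.1 \in A -> s.2 \in A -> f s = 0) ->
  (forall s, s \in pairs n -> `|f s| <= c) ->
  0 <= c ->
  `|\sum_(s in pairs n) f s|
    <= 8 * c * (n%:R ^+ 2 * (1 - #|A|%:R / (2 * n)%:R)).
Proof.
move=> n0 f0 fc c0; apply: le_trans (ler_norm_sum _ _ _) _.
pose D := [set s in pairs n | ~~ ((s.1 \in A) && (s.2 \in A))]%SET.
have cA : (#|A| <= 2 * n)%N by rewrite -[leqRHS]card_ord max_card.
have -> : n%:R ^+ 2 * (1 - #|A|%:R / (2 * n)%:R) =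
    (n * (2 * n - #|A|))%:R / 2 :> R.
  by rewrite !natrM natrB // natrM; field; rewrite pnatr_eq0 -lt0n.
apply: (@le_trans _ _ (c * #|D|%:R)).
  rewrite (bigID [pred s | (s.1 \in A) && (s.2 \in A)]) /= big1 ?add0r;
    last first.
    by move=> s /and3P[sp s1 s2]; rewrite f0 ?normr0.
  rewrite mulr_natr -sumr_const [leRHS](eq_bigl
    (fun s => (s \in pairs n) && ~~ ((s.1 \in A) && (s.2 \in A)))).
    by apply: ler_sum => s /andP[sp _]; exact: fc.
  by move=> s; rewrite inE.
rewrite -mulrA mulrCA ler_wpM2l //.
have : (#|D|%:R <= (2 * ((2 * n - #|A|) * (2 * n)))%:R :> R).
  by rewrite ler_nat card_pairs_notin.
by rewrite !natrM; lra.
Qed.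

(** * Bounds on the two metrics for a fixed [n] *)

Section retained_assignments.
Context (R : realType) (d : measure_display) (T : measurableType d).
Context (P : probability T R) (n : nat) (F : T -> allocation n).
Context (A : {set 'I_(2 * n)}).
Context (n2 : (2 <= n)%N) (mF : random_allocation F).
Context (pA : forall s, s \in pairs n -> s.1 \in A -> s.2 \in A ->
  same_group_prob P F s = s_ R n).

Lemma pairwise_entropy_near1 :
  `|1 - pairwise_entropy P F| <= 24 * (1 - #|A|%:R / (2 * n)%:R).
Proof.
have n2R : (2 : R) <= n%:R by rewrite ler_nat.
pose f s := 1 - plnp (same_group_prob P F s) / plnp (s_ R n).
have h3 := plnp_s_le R n n2.
have h0 : plnp (s_ R n) != 0 by apply: ltr0_neq0; lra.
have /andP[h1 _] := plnp_bounds _ _ (s_itv R n n2).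
have N1 : (n%:R ^+ 2 <= #|pairs n|%:R :> R).
  by rewrite -natrX ler_nat card_pairs_ge.
have N0 : 0 < #|pairs n|%:R :> R.
  by apply: lt_le_trans N1; rewrite exprn_gt0 //; lra.
(* Writing 1 as the average of the constant 1 over [pairs n] makes [1 - E_n] the average of [f]. *)
have -> : 1 - pairwise_entropy P F =
    (#|pairs n|%:R)^-1 * \sum_(s in pairs n) f s.
  rewrite /f sumrB sumr_const -mulr_suml mulrBr mulVf //.
  by rewrite gt_eqF.
(* Both entropy values lie in [[-1, 0]], so they differ by at most 1, and the denominator is at
   least [1/3] in absolute value. *)
have fc s : s \in pairs n -> `|f s| <= 3.
  move=> _; have p01 := same_group_prob_itv _ _ _ P _ _ s mF.
  have /andP[q1 q2] := plnp_bounds _ _ p01.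
  have q0 : plnp (same_group_prob P F s) <= 0.
    by apply: le_trans q2 _; rewrite oppr_le0; nra.
  have -> : f s =
      (plnp (s_ R n) - plnp (same_group_prob P F s)) / plnp (s_ R n).
    by rewrite /f mulrBl mulfV.
  rewrite normrM normfV [X in _ / X]ler0_norm; last by lra.
  rewrite ler_pdivrMr; last by lra.
  by rewrite ler_norml; lra.
have f0 s : s \in pairs n -> s.1 \in A -> s.2 \in A -> f s = 0.
  by move=> sp s1 s2; rewrite /f pA // mulfV ?subrr.
have := sum_pairs_le R n A f 3 (ltnW n2) f0 fc (ler0n _ _).
set S := \sum_(s in _) _; set e := 1 - _ => hS.
have e0 : 0 <= e.
  rewrite subr_ge0 ler_pdivrMr ?mul1r ?ler_nat ?ltr0n; last by lia.
  by rewrite -[leqRHS]card_ord max_card.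
rewrite normrM normfV normr_nat mulrC ler_pdivrMr //.
(* Since [e >= 0] and [n^2 <= |S|], the bound [24 n^2 e] on the sum is at most [24 e |S|]. *)
apply: le_trans hS _; nra.
Qed.

Lemma standard_error_le :
  0 <= standard_error P F <= Num.sqrt (24 * (1 - #|A|%:R / (2 * n)%:R)).
Proof.
have n2R : (2 : R) <= n%:R by rewrite ler_nat.
rewrite /standard_error mulr_ge0 ?invr_ge0 ?sqrtr_ge0 ?ler0n //=.
set f := fun s => (same_group_prob P F s - (n%:R - 1) / (2 * n%:R - 1)) ^+ 2.
have fc s : s \in pairs n -> `|f s| <= 1.
  move=> _; rewrite normrX expr_le1 // ler_norml.
  have := same_group_prob_itv _ _ _ P _ _ s mF.
  have := s_itv R n n2; rewrite /s_; lra.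
have f0 s : s \in pairs n -> s.1 \in A -> s.2 \in A -> f s = 0.
  by move=> sp s1 s2; rewrite /f pA // /s_ subrr expr0n.
have := sum_pairs_le R n A f 1 (ltnW n2) f0 fc ler01.
set e := 1 - _; rewrite ger0_norm; last first.
  by apply: sumr_ge0 => s _; exact: sqr_ge0.
set S := \sum_(s in _) _ => hS.
have S0 : 0 <= S by apply: sumr_ge0 => s _; exact: sqr_ge0.
(* The value 3 is attained at [n = 2]; with the 8 of [sum_pairs_le] it gives the constant 24. *)
have q3 : 0 <= (2 * n%:R - 1) / (n%:R - 1 : R) <= 3.
  by rewrite divr_ge0 ?ler_pdivrMr; lra.
(* The factor [1/n] goes under the root, so that only radicands have to be compared. *)
have -> : n%:R^-1 = Num.sqrt (n%:R ^- 2) :> R.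
  by rewrite -exprVn sqrtr_sqr ger0_norm // invr_ge0.
rewrite -sqrtrM ?invr_ge0 ?exprn_ge0 // ler_sqrt.
  rewrite mulrC ler_pdivrMr ?exprn_gt0 //; last by lra.
  apply: (@le_trans _ _ (3 * S)); first by apply: ler_wpM2r => //; lra.
  lra.
(* Comparing the roots leaves the side condition [0 <= 24 * e]; the sign of [e] is read off from
   [0 <= S <= 8 n^2 e]. *)
have : 0 <= 8 * 1 * (n%:R ^+ 2 * e) by exact: le_trans hS.
rewrite !pmulr_rge0 //; try lra.
by rewrite exprn_gt0 //; lra.
Qed.

End retained_assignments.

(** * Passage to the limit *)

Theorem theorem3 (R : realType)
    (d : nat -> measure_display)
    (T : forall n : nat, measurableType (d n))
    (P : forall n : nat, probability (T n) R)
    (initial final : forall n : nat, T n -> allocation n)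
    (A : forall n : nat, {set 'I_(2 * n)})
    (initial_uniform : forall n : nat, (2 <= n)%N ->
       uniform_allocation (P n) (initial n))
    (final_random : forall n : nat, (2 <= n)%N ->
       random_allocation (final n))
    (retained : forall n : nat, (2 <= n)%N ->
       forall (w : T n) (i : 'I_(2 * n)), i \in A n ->
         treated (final n w) i = treated (initial n w) i)
    (A_full : (#|A n|%:R / (2 * n)%:R : R) @[n --> \oo] --> (1 : R)) :
  (pairwise_entropy (P n) (final n) @[n --> \oo] --> (1 : R)) /\
  (standard_error (P n) (final n) @[n --> \oo] --> (0 : R)).
Proof.
pose e n : R := 24 * (1 - #|A n|%:R / (2 * n)%:R).
have e0 : e n @[n --> \oo] --> (0 : R).
  rewrite -(mulr0 24) -(subrr 1).
  by apply: cvgMr; apply: cvgB => //; exact: cvg_cst.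
have pA n : (2 <= n)%N ->
    forall s, s \in pairs n -> s.1 \in A n -> s.2 \in A n ->
    same_group_prob (P n) (final n) s = s_ R n.
  move=> n2 s sp s1 s2.
  (* For a pair inside [A n] the final and initial same-group events are equal as sets, so the
     uniform value carries over. *)
  rewrite -(same_group_prob_uniform _ _ _ (P n) _ (initial n) s
    (initial_uniform n n2)).
    rewrite /same_group_prob; congr (fine (P n _)).
    by apply/seteqP; split=> w /=; rewrite !retained.
  by move: sp; rewrite inE => /ltn_eqF/negbT.
split.
- apply/cvgrPdist_le => eps eps0.
  have /cvgr0Pnorm_le/(_ _ eps0) := e0.
  (* The bound by [e n] holds only from [n = 2] on, hence the intersection with this tail. *)
  apply: filterS2 (nbhs_infty_ge 2) => n n2 en.
  apply: le_trans (pairwise_entropy_near1 _ _ _ (P n) _ _ (A n) n2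
    (final_random n n2) (pA n n2)) _.
  exact: le_trans (ler_norm _) en.
- apply: (@squeeze_cvgr _ _ _ _ (fun=> 0) (fun n => Num.sqrt (e n))).
  + near=> n; apply: standard_error_le.
    * by near: n; exact: nbhs_infty_ge.
    * by apply: final_random; near: n; exact: nbhs_infty_ge.
    * by apply: pA; near: n; exact: nbhs_infty_ge.
  + exact: cvg_cst.
  (* The upper bound tends to [Num.sqrt 0 = 0] by continuity of the root at 0. *)
  + rewrite -(sqrtr0 R); apply: (cvg_comp e Num.sqrt e0).
    exact: sqrt_continuous.
Unshelve. all: by end_near.
Qed.
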